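(* Consider a two-node cycle with true parameters $a_{12}^0=a_{21}^0=a$, $a\neq 0$, which is stable (i.e. $|a_{12}^0a_{21}^0|<1$) and uniformly excited ($\sigma_1^2=\sigma_2^2=\sigma^2>0$ and $\lambda_1=\lambda_2=\lambda>0$). Let $P^{\mathrm{I}},P^{\mathrm{II}},P^{\mathrm{III}},P^{\mathrm{IV}}$ be the asymptotic covariance matrices of the estimates of $(a_{12},a_{21})$ under the four excitation and measurement patterns (I) $\mathcal B=\{1,2\},\ \mathcal C=\{1\}$; (II) $\mathcal B=\{1,2\},\ \mathcal C=\{2\}$; (III) $\mathcal B=\{1\},\ \mathcal C=\{1,2\}$; (IV) $\mathcal B=\{2\},\ \mathcal C=\{1,2\}$, and let $\mathrm{var}(\hat a_{12}^{j})$ and $\mathrm{var}(\hat a_{21}^{j})$ denote the first and second diagonal entries of $P^{j}$. Then: 1. $P^{\mathrm{I}}=P^{\mathrm{IV}}$ and $P^{\mathrm{II}}=P^{\mathrm{III}}$; 2. $\mathrm{tr}(P^{\mathrm{I}})=\mathrm{tr}(P^{\mathrm{II}})=\mathrm{tr}(P^{\mathrm{III}})=\mathrm{tr}(P^{\mathrm{IV}})$; 3. $\mathrm{var}(\hat a_{12}^{\mathrm{I}})<\mathrm{var}(\hat a_{12}^{\mathrm{II}})$, $\mathrm{var}(\hat a_{21}^{\mathrm{I}})>\mathrm{var}(\hat a_{21}^{\mathrm{II}})$, $\mathrm{var}(\hat a_{12}^{\mathrm{IV}})<\mathrm{var}(\hat a_{12}^{\mathrm{III}})$ and $\mathrm{var}(\hat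 a_{21}^{\mathrm{IV}})>\mathrm{var}(\hat a_{21}^{\mathrm{III}})$.
   Context: A dynamic network with $n$ nodes is $w(t)=G^0(q)w(t)+Br(t)$, $y(t)=Cw(t)+e(t)$, $t\in\mathbb Z$, where $q$ is the forward shift operator ($qr(t)=r(t+1)$), $w(t)\in\mathbb R^n$ are the node signals, $r$ the external excitations, $y$ the measured outputs, $e$ the measurement noise. $B$ and $C$ are binary selection matrices; $\mathcal B$ is the set of nodes $i$ to which an external signal $r_i$ is applied, and $\mathcal C$ is the set of nodes $j$ that are measured, $y_j=w_j+e_j$. The pair $(\mathcal B,\mathcal C)$ is called an excitation and measurement pattern (EMP). The two-node cycle has $G^0(q)=q^{-1}\begin{bmatrix}0&a_{12}^0\\ a_{21}^0&0\end{bmatrix}$ with real nonzero $a_{12}^0,a_{21}^0$, i.e. $w_1(t)=a_{12}^0w_2(t-1)+r_1(t)$, $w_2(t)=a_{21}^0w_1(t-1)+r_2(t)$, with $r_i\equiv 0$ if $i\notin\mathcal B$; signals are the stationary solutions. Assumptions: the network is stable; the $r_i$, $i\in\mathcal B$, are mutually independent stationary zero-mean white noise processes with variances $\sigma_i^2>0$, uncorrelated with the noises; the $e_j$, $j\in\mathcal C$, are independent stationary Gaussian zero-mean white noise processes with variances $\lambda_j>0$. For a parameter vector $\theta=(a_{12},a_{21})$, let $G(q,\theta)$ be the network matrix with $a_{ij}$ in place of $a_{ij}^0$. The optimal one-step-ahead predictor is $\hat y(t|t-1;\theta)=C(I-G(q,\theta))^{-1}Br(t)$. Let $\psi(t)$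 be the $2\times|\mathcal C|$ matrix whose entry in the row of parameter $\theta_k$ and column of output $j\in\mathcal C$ is $\partial \hat y_j(t|t-1;\theta)/\partial\theta_k$ evaluated at the true parameter, and $\Lambda=\mathrm{diag}(\lambda_j)_{j\in\mathcal C}$. The asymptotic covariance matrix of the EMP is $P=[\mathbb E\,\psi(t)\Lambda^{-1}\psi(t)^T]^{-1}$. *)

(* Defs.v *)
From HB Require Import structures.
From mathcomp Require Import all_boot all_order all_algebra.
From mathcomp Require Import all_classical all_reals all_analysis.

Set Implicit Arguments.
Unset Strict Implicit.
Unset Printing Implicit Defensive.

Import Order.TTheory GRing.Theory Num.Theory.
Import numFieldNormedType.Exports.

Local Open Scope classical_set_scope.
Local Open Scope ring_scope.

Section Processes.
Context {R : realType} {d : measure_display} {T : measurableType d}.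
Variable P : probability T R.

(* Whiteness is meant in the second-order sense (uncorrelated samples); with a
   constant mean and a constant variance this includes wide-sense
   stationarity. *)
Definition white_noise (x : int -> {RV P >-> R}) (s2 : R) : Prop :=
  [/\ forall t, (x t : T -> R) \in Lfun P 2%:E,
      forall t, 'E_P[x t]%E = 0%E,
      forall t, 'V_P[x t]%E = s2%:E
    & forall s t, s <> t -> covariance P (x s) (x t) = 0%E].

(* Point masses are Gaussian laws too, but [normal_prob m 0] is not one. *)
Definition gaussian_rv (X : T -> R) : Prop :=
  (exists m s : R, 0 < s /\
     forall V : set R, measurable V -> P (X @^-1` V) = normal_prob m s V)
  \/ (exists c : R, {ae P, forall w, X w = c}).

Definition gaussian_process (x : int -> {RV P >-> R}) : Prop :=
  forall (s : seq int) (c : int -> R),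
    gaussian_rv (fun w => \sum_(t <- s) c t * x t w).

(* Mutual independence of the sigma-algebras generated by the processes x_i,
   i \in A, tested on the generating pi-systems of finite-dimensional
   cylinders. A subfamily is obtained by taking E i t := setT. *)
Definition independent_processes (I : finType) (A : {set I})
    (x : I -> int -> {RV P >-> R}) : Prop :=
  forall (s : I -> seq int) (E : I -> int -> set R),
    (forall i t, measurable (E i t)) ->
    let cylinder i := [set w | forall t, t \in s i -> E i t (x i t w)] in
    fine (P [set w | forall i, i \in A -> cylinder i w]) =
    \prod_(i in A) fine (P (cylinder i)).

End Processes.

(* The processes available in an experiment with EMP (B, C). Only the r_i with
   i \in B and the e_j with j \in C are constrained, and only those r_i are
   used below, through the selection matrix of B. *)
Record experiment (R : realType) (n : nat) (B C : {set 'I_n})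
    (sigma2 lambda : 'I_n -> R) := Experiment {
  disp : measure_display;
  Omega : measurableType disp;
  prob : probability Omega R;
  exc : 'I_n -> int -> {RV prob >-> R};
  noise : 'I_n -> int -> {RV prob >-> R};
  exc_white : forall i, i \in B -> white_noise (exc i) (sigma2 i);
  exc_indep : independent_processes B exc;
  noise_white : forall j, j \in C -> white_noise (noise j) (lambda j);
  noise_gauss : forall j, j \in C -> gaussian_process (noise j);
  noise_indep : independent_processes C noise;
  exc_noise_uncorr : forall i j s t, i \in B -> j \in C ->
    covariance prob (exc i s) (noise j t) = 0%E
}.

(* Binary selection matrices: (select_in B) sends the reduced excitation vector
   (r_i)_{i in B} to the nodes, (select_out C) extracts (w_j)_{j in C}. *)
Definition select_in (R : realType) (n : nat) (B : {set 'I_n}) :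
    'M[R]_(n, #|B|) := \matrix_(i, k) (i == enum_val k)%:R.

Definition select_out (R : realType) (n : nat) (C : {set 'I_n}) :
    'M[R]_(#|C|, n) := \matrix_(k, j) (j == enum_val k)%:R.

Section Predictor.
Context {R : realType} {n : nat} {B C : {set 'I_n}}.
Context {sigma2 lambda : 'I_n -> R}.
Variable X : experiment B C sigma2 lambda.

Definition exc_vec (t : int) (w : Omega X) : 'cV[R]_#|B| :=
  \col_k exc X (enum_val k) t w.

(* For G(q) = q^-1 A, the causal filter (I - G(q))^-1 is
   \sum_(k >= 0) A^k q^-k. The series of random variables is summed
   pathwise. *)
Definition node_signal (A : 'M[R]_n) (t : int) (w : Omega X) : 'cV[R]_n :=
  \col_i limn (series (fun k : nat =>
    (A ^+ k *m select_in R B *m exc_vec (t - k%:Z) w) i 0)).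

Definition predictor (A : 'M[R]_n) (t : int) (w : Omega X) : 'cV[R]_#|C| :=
  select_out R C *m node_signal A t w.

Context {p : nat}.
(* The parametrized network is G(q, theta) = q^-1 (A theta). *)
Variables (A : 'rV[R]_p -> 'M[R]_n) (theta0 : 'rV[R]_p).

Definition psi (t : int) (w : Omega X) : 'M[R]_(p, #|C|) :=
  \matrix_(k, j)
    'D_(delta_mx 0 k) (fun theta => predictor (A theta) t w j 0) theta0.

Definition noise_cov : 'M[R]_#|C| := diag_mx (\row_j lambda (enum_val j)).

Definition information_mx (t : int) : 'M[R]_p :=
  \matrix_(k, l) fine 'E_(prob X)[fun w =>
    (psi t w *m invmx noise_cov *m (psi t w)^T) k l].

Definition asymptotic_cov (t : int) : 'M[R]_p := invmx (information_mx t).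

End Predictor.

Definition node1 : 'I_2 := 0.
Definition node2 : 'I_2 := 1.

(* Parameter vectors are theta = (a12, a21). *)
Definition par_a12 : 'I_2 := 0.
Definition par_a21 : 'I_2 := 1.

Definition two_node_cycle (R : realType) (theta : 'rV[R]_2) : 'M[R]_2 :=
  \matrix_(i, j)
    if (i == node1) && (j == node2) then theta 0 par_a12
    else if (i == node2) && (j == node1) then theta 0 par_a21
    else 0.

(* Main.v *)
Require Import Defs.
From HB Require Import structures.
From mathcomp Require Import all_boot all_order all_algebra.
From mathcomp Require Import all_classical all_reals all_analysis.
From mathcomp Require Import measurable_realfun.
From mathcomp Require Import ring lra.

Set Implicit Arguments.
Unset Strict Implicit.
Unset Printing Implicit Defensive.

Import Order.TTheory GRing.Theory Num.Theory.
Import numFieldNormedType.Exports.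

Local Open Scope ring_scope.

(** Let [D_k(m)] be the derivative of [A(theta)^m] with respect to the [k]-th
    parameter at the true parameter. The predictor of output [j] is the filter
    [sum_m sum_i (A(theta)^m)_(j,i) r_i(t - m)], so its gradient is the filter with
    coefficients [D_k(m)_(j,i)]. The excitations are white and mutually
    uncorrelated; hence the information matrix, the inverse of the asymptotic
    covariance, has entries
    [sum_(j in C) sum_(i in B) sigma_i^2 / lambda_j * sum_m D_k(m)_(j,i) D_l(m)_(j,i)],
    which is [information_mxE]. Each pair of an excited node [i] and a measured node
    [j] thus contributes a matrix of its own.

    For the symmetric cycle ([dmxpow_cycleE]) the pairs (1,1) and (2,2) contribute
    the same matrix, whose entries are all equal, because a walk from a node to
    itself uses both edges equally often. The pair [j = 1], [i = 2] contributes a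
    matrix that differs from that of [j = 2], [i = 1] by an exchange of the two
    parameters. Patterns I and IV consist of one pair of the first kind together
    with [j = 1], [i = 2]; patterns II and III of one pair of the first kind
    together with [j = 2], [i = 1]. So there are only two information matrices,
    exchanged by permuting the parameters, which gives the equalities of the
    covariances and of their traces. The strict inequalities hold because a walk
    from node 2 to node 1 uses the edge of [a12] once more than that of [a21], so it
    carries more information on [a12] ([path_energy_lt]). The information matrix is
    invertible because the sensitivities to the two parameters are not
    proportional ([cycle_energy_det_gt0]).

    The analysis behind [information_mxE] is that the predictor is a random series
    summed path by path. Almost every path of the excitation has finite [energy],
    a geometrically discounted sum of squares. On such a path the series converges
    and may be differentiated termwise ([filter_derive]), given Cauchy-type bounds
    on the powers of a perturbed matrix ([expmx_taylor_le]). The expectations of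
    products of gradients follow by dominated convergence, the energy being the
    dominating function ([cvg_filter_product]). On the remaining null set the
    gradient is an arbitrary function, which does not affect the expectation
    ([integral_conull]). *)

(** * Integration over a set of full measure *)

Section IntegralCoNull.
Local Open Scope classical_set_scope.
Local Open Scope ereal_scope.
Import HBNNSimple.
Context d (T : measurableType d) (R : realType).
Variable mu : {measure set T -> \bar R}.

(** Truncating to [G] a simple function below [f] changes its integral only on
    a null set, so restricting to [G] does not change the supremum that defines
    the integral of [f]. *)
Lemma ge0_integral_conull (G : set T) (f : T -> \bar R) :
  measurable G -> mu (~` G) = 0 -> (forall x, 0 <= f x) ->
  \int[mu]_x f x = \int[mu]_(x in G) f x.
Proof.
move=> mG G0 f0; rewrite [RHS]integral_mkcond.
have fG0 x : 0 <= (f \_ G) x by rewrite patchE; case: ifP.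
rewrite !ge0_integralTE//; apply/le_anti/andP; split.
- apply: ge_ereal_sup => _ [h /= hf <-].
  have -> : sintegral mu h = sintegral mu (proj_nnsfun h mG).
    rewrite -!integralT_nnsfun; apply: ae_eq_integral => //.
    + by apply/measurable_EFinP.
    + by apply/measurable_EFinP.
    exists (~` G); split => // [|x /= hx Gx]; first exact: measurableC.
    apply: hx => _; congr EFin.
    by rewrite mindicE mem_set// mulr1.
  apply: ereal_sup_ubound; exists (proj_nnsfun h mG) => // x /=.
  rewrite mindicE patchE; case: ifPn => xG; first by rewrite mulr1.
  by rewrite mulr0.
- apply: le_ereal_sup => _ [h /= hf <-]; exists h => // x.
  apply: (le_trans (hf x)); rewrite patchE; case: ifP => //.
Qed.

(** This is what makes the expectations below insensitive to the paths on which
    the predictor series diverges: there the gradient is the limit of a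
    non-convergent filter, a function about whose measurability nothing is
    known, which rules out comparing integrals by almost-everywhere equality. *)
Lemma integral_conull (G : set T) (f : T -> \bar R) :
  measurable G -> mu (~` G) = 0 ->
  \int[mu]_x f x = \int[mu]_(x in G) f x.
Proof.
move=> mG G0; rewrite integralE [RHS]integralE.
by rewrite !(ge0_integral_conull mG G0).
Qed.

End IntegralCoNull.

(** * Independence and second moments *)

Section Independence.
Local Open Scope classical_set_scope.
Local Open Scope ereal_scope.
Context d (T : measurableType d) (R : realType) (P : probability T R).

(** The product rule says that the law of [(X, Y)] is the product of the laws of
    [X] and [Y]; the claim is then Fubini's theorem for [(x, y) |-> x * y]. *)
Lemma expectationM_indep (X Y : {RV P >-> R}) :
  (X : T -> R) \in Lfun P 1 -> (Y : T -> R) \in Lfun P 1 ->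
  (X \* Y)%R \in Lfun P 1 ->
  (forall E F : set R, measurable E -> measurable F ->
     P ((X @^-1` E) `&` (Y @^-1` F)) = P (X @^-1` E) * P (Y @^-1` F)) ->
  'E_P[X \* Y] = 'E_P[X] * 'E_P[Y].
Proof.
move=> /Lfun1_integrable iX /Lfun1_integrable iY /Lfun1_integrable iXY XYindep.
pose phi w : R * R := (X w, Y w).
have mphi : measurable_fun [set: T] phi by exact: measurable_fun_pair.
pose f (z : R * R) := (z.1 * z.2)%:E.
have mf : measurable_fun [set: R * R] f.
  by apply/measurable_EFinP; apply: measurable_funM.
have ifphi : P.-integrable (phi @^-1` [set: R * R]) (f \o phi) by exact: iXY.
pose mX : {sigma_finite_measure set _ -> \bar R} := distribution P X.
pose mY : {sigma_finite_measure set _ -> \bar R} := distribution P Y.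
have prodE A : measurable A -> (mX \x mY) A = pushforward P phi A.
  move: A.
  apply: (@product_measure_unique _ _ _ _ _ mX mY (pushforward P phi)).
  move=> A B mA mB.
  by rewrite -[RHS]XYindep.
have absE : \int[mX \x mY]_z `|f z| = \int[P]_w `|(f \o phi) w|.
  transitivity (\int[pushforward P phi]_z `|f z|).
    by apply: eq_measure_integral => A mA _; exact: prodE.
  rewrite ge0_integral_pushforward//.
  by apply: measurableT_comp.
have iprod : (mX \x mY).-integrable [set: R * R] f.
  apply/integrableP; split => //.
  by rewrite absE; case/integrableP : iXY.
have E1 : \int[mX \x mY]_z f z = \int[P]_w (f \o phi) w.
  transitivity (\int[pushforward P phi]_z f z).
    by apply: eq_measure_integral => A mA _; exact: prodE.
  by rewrite integral_pushforward.
have EX : \int[mX]_x x%:E = 'E_P[X].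
  by rewrite integral_distribution// unlock.
have EY : \int[mY]_x x%:E = 'E_P[Y].
  by rewrite integral_distribution// unlock.
have iidX : mX.-integrable [set: R] EFin by exact: integrable_pushforward.
have iidY : mY.-integrable [set: R] EFin by exact: integrable_pushforward.
have finEY : 'E_P[Y] \is a fin_num.
  by rewrite expectation_fin_num//; exact/Lfun1_integrable.
rewrite [in LHS]unlock -[LHS]/(\int[P]_w (f \o phi) w) -E1.
rewrite -(integral12_prod_meas1 iprod).
under eq_integral => x _.
  rewrite /fubini_F /f /=.
  under eq_integral do rewrite EFinM.
  rewrite integralZl// EY -(fineK finEY).
  over.
by rewrite integralZr// EX fineK.
Qed.

End Independence.

Section Correlations.
Local Open Scope classical_set_scope.
Context d (T : measurableType d) (R : realType) (P : probability T R).

(** The product rule for processes, tested on the cylinders that constrain only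
    [x i] at time [s] and [x j] at time [t]. *)
Lemma independent_processes_pair (I : finType) (A : {set I})
    (x : I -> int -> {RV P >-> R}) (i j : I) (s t : int) (E F : set R) :
  independent_processes A x -> i \in A -> j \in A -> i != j ->
  measurable E -> measurable F ->
  P ((x i s @^-1` E) `&` (x j t @^-1` F)) =
  (P (x i s @^-1` E) * P (x j t @^-1` F))%E.
Proof.
move=> indep iA jA ij mE mF.
pose times k := if k == i then [:: s] else if k == j then [:: t] else [::].
pose events k (_ : int) := if k == i then E else if k == j then F else setT.
have mevents k r : measurable (events k r).
  by rewrite /events; case: ifP => // _; case: ifP.
pose cyl k := [set w | forall r, r \in times k -> events k r (x k r w)].
have indepE : fine (P [set w | forall k, k \in A -> cyl k w]) =
    \prod_(k in A) fine (P (cyl k)) by exact: (indep times events mevents).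
have ji : (j == i) = false by rewrite eq_sym (negbTE ij).
have cyli : cyl i = x i s @^-1` E.
  apply/seteqP; split=> w /=; rewrite /cyl /times /events /= eqxx.
    by apply; rewrite mem_head.
  by move=> Ew r; rewrite inE => /eqP ->.
have cylj : cyl j = x j t @^-1` F.
  apply/seteqP; split=> w /=; rewrite /cyl /times /events /= ji eqxx.
    by apply; rewrite mem_head.
  by move=> Fw r; rewrite inE => /eqP ->.
have cylk k : k != i -> k != j -> cyl k = setT.
  move=> ki kj; apply/seteqP; split=> // w _ r.
  by rewrite /times /= (negbTE ki) (negbTE kj).
have interE : [set w | forall k, k \in A -> cyl k w] =
          (x i s @^-1` E) `&` (x j t @^-1` F).
  rewrite -cyli -cylj; apply/seteqP; split=> w /=.
    by move=> h; split; exact: h.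
  move=> [iw jw] k kA; have [->//|ki] := eqVneq k i.
  have [->//|kj] := eqVneq k j.
  by rewrite cylk.
have mX : measurable (x i s @^-1` E) by exact: measurable_funPTI.
have mY : measurable (x j t @^-1` F) by exact: measurable_funPTI.
rewrite -[LHS]fineK ?fin_num_measure//; last exact: measurableI.
rewrite -interE indepE (bigD1 i)//= (bigD1 j) ?jA//=; last by rewrite eq_sym.
rewrite big1 => [|k /andP[/andP[kA ki] kj]].
  by rewrite mulr1 cyli cylj EFinM !fineK// fin_num_measure.
by rewrite cylk// probability_setT.
Qed.

Lemma white_noise_moment (x : int -> {RV P >-> R}) (s2 : R) (s t : int) :
  white_noise x s2 -> 'E_P[x s \* x t]%E = ((s == t)%:R * s2)%:E.
Proof.
move=> [xL2 x0 xV xC].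
have xL1 r : (x r : T -> R) \in Lfun P 1.
  by apply: Lfun_subset12; rewrite ?fin_num_measure.
have covE r r' : covariance P (x r) (x r') = 'E_P[x r \* x r']%E.
  rewrite covarianceE ?x0 ?mul0e ?sube0//.
  exact: Lfun2_mul_Lfun1.
rewrite -covE; have [<-|/eqP/xC ->] := eqVneq s t; last by rewrite mul0r.
by rewrite mul1r -(xV s).
Qed.

(** Samples at different times are uncorrelated by whiteness, samples of
    different processes by independence. *)
Lemma white_noise_cross_moment (I : finType) (A : {set I})
    (x : I -> int -> {RV P >-> R}) (v : I -> R) (i j : I) (s t : int) :
  (forall k, k \in A -> white_noise (x k) (v k)) ->
  independent_processes A x -> i \in A -> j \in A ->
  'E_P[x i s \* x j t]%E = (((s == t) && (i == j))%:R * v i)%:E.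
Proof.
move=> xW indep iA jA; have [<-|ij] := eqVneq i j.
  by rewrite andbT (white_noise_moment _ _ (xW i iA)).
have [iL2 i0 _ _] := xW i iA; have [jL2 j0 _ _] := xW j jA.
rewrite andbF mul0r expectationM_indep.
- by rewrite i0 mul0e.
- by apply: Lfun_subset12; rewrite ?fin_num_measure.
- by apply: Lfun_subset12; rewrite ?fin_num_measure.
- exact: Lfun2_mul_Lfun1.
- by move=> E F mE mF; exact: (independent_processes_pair _ _ indep).
Qed.

End Correlations.

(** * Filters along a fixed path *)

(** Cauchy-Schwarz with weights. Adding one index to the sums adds the
    nonnegative quantity [\sum_(j <- s) w j * (x j - x i) ^+ 2], times [w i], to
    the difference of the two sides. *)
Lemma sqr_weighted_sum_le (R : realFieldType) (I : Type) (s : seq I)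
    (w x : I -> R) : (forall i, 0 <= w i) ->
  (\sum_(i <- s) w i * x i) ^+ 2 <=
  (\sum_(i <- s) w i) * (\sum_(i <- s) w i * x i ^+ 2).
Proof.
move=> w0; elim: s => [|i s IHs]; first by rewrite !big_nil mul0r expr0n.
rewrite !big_cons; set W := \sum_(j <- s) w j.
set M := \sum_(j <- s) w j * x j; set Q := \sum_(j <- s) w j * x j ^+ 2.
have /(mulr_ge0 (w0 i)) : 0 <= Q - 2 * x i * M + x i ^+ 2 * W.
  rewrite /Q /M /W !mulr_sumr -sumrB -big_split/=; apply: sumr_ge0 => j _.
  rewrite (_ : _ + _ = w j * (x j - x i) ^+ 2); last by ring.
  by rewrite mulr_ge0// sqr_ge0.
move: IHs; rewrite -/W -/M -/Q => IHs.
move: (w i) (x i) => a y.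
nra.
Qed.

Section Paths.
Local Open Scope classical_set_scope.
Context (R : realType) (q : nat) (rho : R).
Hypotheses (rho0 : 0 <= rho) (rho1 : rho < 1).

(** Here [r n b] stands for the [b]-th input [n] time steps ago. The energy is
    taken in the extended reals, so that its finiteness is a condition on the
    path: it makes every filter with coefficients of order [rho ^+ n] converge. *)
Definition energy (r : nat -> 'I_q -> R) : \bar R :=
  (\sum_(n <oo) (rho ^+ n * \sum_b r n b ^+ 2)%:E)%E.

Implicit Types (r c d : nat -> 'I_q -> R).

Definition filter_term c r (n : nat) : R := \sum_b c n b * r n b.

Let energy_term_ge0 r n : 0 <= rho ^+ n * \sum_b r n b ^+ 2.
Proof. by rewrite mulr_ge0 ?exprn_ge0// sumr_ge0// => b _; rewrite sqr_ge0. Qed.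

Lemma energy_ge0 r : (0 <= energy r)%E.
Proof. by apply: nneseries_ge0 => n _ _; rewrite lee_fin. Qed.

Lemma energy_partial_le r N : (energy r < +oo)%E ->
  \sum_(n < N) rho ^+ n * (\sum_b r n b ^+ 2) <= fine (energy r).
Proof.
move=> roo; rewrite -lee_fin fineK; last first.
  by rewrite ge0_fin_numE// energy_ge0.
rewrite -sumEFin -(big_mkord xpredT (fun n => (rho ^+ n * \sum_b r n b ^+ 2)%:E)).
by apply: nneseries_lim_ge => n _ _; rewrite lee_fin.
Qed.

Lemma geometric_partial_le N : \sum_(n < N) rho ^+ n <= (1 - rho)^-1.
Proof.
rewrite -[leRHS]mul1r ler_pdivlMr ?subr_gt0//.
rewrite mulrC -opprB mulNr -subrX1 opprB gerBl exprn_ge0//.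
Qed.

(** From [x <= 1 + x ^+ 2], the energy and a geometric series dominate. *)
Lemma path_summable r : (energy r < +oo)%E ->
  cvgn (series (fun n => rho ^+ n * \sum_b `|r n b|)).
Proof.
move=> roo; apply: nondecreasing_is_cvgn.
  apply/nondecreasing_seqP => N; rewrite seriesSr lerDl.
  by rewrite mulr_ge0 ?exprn_ge0// sumr_ge0.
exists (q%:R * (1 - rho)^-1 + fine (energy r)) => _ [N _ <-].
rewrite seriesEord/=.
apply: (@le_trans _ _ (\sum_(n < N) (q%:R * rho ^+ n + rho ^+ n * \sum_b r n b ^+ 2))).
  apply: ler_sum => n _; rewrite (mulrC q%:R) -mulrDr ler_wpM2l ?exprn_ge0//.
  rewrite -[q in q%:R]card_ord -sum1_card natr_sum -big_split/=.
  apply: ler_sum => b _; rewrite -[r n b ^+ 2]real_normK ?num_real//.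
  have := normr_ge0 (r n b); move: `|r n b| => x; nra.
rewrite big_split/= -mulr_sumr lerD ?energy_partial_le//.
by rewrite ler_wpM2l// geometric_partial_le.
Qed.

Section OneFilter.
Variables (c : nat -> 'I_q -> R) (r : nat -> 'I_q -> R) (K : R).
Hypotheses (K0 : 0 <= K) (cK : forall n b, `|c n b| <= K * rho ^+ n).
Hypothesis roo : (energy r < +oo)%E.

Lemma filter_term_le n :
  `|filter_term c r n| <= K * (rho ^+ n * \sum_b `|r n b|).
Proof.
rewrite (le_trans (ler_norm_sum _ _ _))// !mulr_sumr.
by apply: ler_sum => b _; rewrite normrM mulrA ler_wpM2r.
Qed.

Lemma filter_normed_cvg : cvgn [normed series (filter_term c r)].
Proof.
apply: (@series_le_cvg _ _ (K *: (fun n => rho ^+ n * \sum_b `|r n b|))) => //.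
- by move=> n /=; exact: normr_ge0.
- move=> n; apply: mulr_ge0 => //.
  by rewrite mulr_ge0 ?exprn_ge0// sumr_ge0.
- exact: filter_term_le.
- by apply: is_cvg_seriesZ; exact: path_summable.
Qed.

Lemma filter_cvg : cvgn (series (filter_term c r)).
Proof. by apply: normed_cvg; exact: filter_normed_cvg. Qed.

Lemma filter_lim_le : `|limn (series (filter_term c r))| <=
  K * limn (series (fun n => rho ^+ n * \sum_b `|r n b|)).
Proof.
apply: (le_trans (lim_series_norm filter_normed_cvg)).
rewrite -[leRHS]/(K *: _) -lim_seriesZ; last exact: path_summable.
apply: lim_series_le; first exact: filter_normed_cvg.
  by apply: is_cvg_seriesZ; exact: path_summable.
exact: filter_term_le.
Qed.

(** The bound is uniform in [N] and linear in the energy, which is integrable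
    for white inputs: it serves as the dominating function. *)
Lemma filter_partial_sqr_le N : (series (filter_term c r) N) ^+ 2 <=
  K ^+ 2 * (q%:R / (1 - rho)) * fine (energy r).
Proof.
apply: (@le_trans _ _ ((K * \sum_(p : 'I_N * 'I_q) rho ^+ p.1 * `|r p.1 p.2|) ^+ 2)).
  rewrite -[leLHS]ger0_norm ?sqr_ge0// normrX lerXn2r ?nnegrE//.
    rewrite mulr_ge0// sumr_ge0// => p _.
    by rewrite mulr_ge0 ?exprn_ge0.
  rewrite seriesEord/= (le_trans (ler_norm_sum _ _ _))// mulr_sumr.
  rewrite -(pair_bigA _ (fun (n : 'I_N) b => K * (rho ^+ n * `|r n b|)))/=.
  apply: ler_sum => n _; rewrite (le_trans (filter_term_le n))//.
  by rewrite !mulr_sumr.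
rewrite exprMn -mulrA ler_wpM2l ?sqr_ge0//.
apply: (le_trans (@sqr_weighted_sum_le _ _ _ (fun p : 'I_N * 'I_q => rho ^+ p.1)
  (fun p => `|r p.1 p.2|) _)) => [p|]; first by rewrite exprn_ge0.
apply: ler_pM.
- by apply: sumr_ge0 => p _; rewrite exprn_ge0.
- by apply: sumr_ge0 => p _; rewrite mulr_ge0 ?exprn_ge0// sqr_ge0.
- rewrite -(pair_bigA _ (fun (n : 'I_N) (b : 'I_q) => rho ^+ n))/=.
  under eq_bigr do rewrite sumr_const card_ord -mulr_natl.
  by rewrite -mulr_sumr ler_wpM2l// geometric_partial_le.
- rewrite -(pair_bigA _ (fun (n : 'I_N) (b : 'I_q) => rho ^+ n * `|r n b| ^+ 2))/=.
  apply: le_trans (energy_partial_le N roo).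
  apply: ler_sum => n _; rewrite mulr_sumr; apply: ler_sum => b _.
  by rewrite real_normK// num_real.
Qed.

End OneFilter.

(** Termwise differentiation: a second-order Taylor bound on the coefficients,
    uniform in [b] and geometric in [n], makes the difference quotient differ from
    the differentiated filter by [O(h)], since the path is summable. *)
Lemma filter_derive (c : R -> nat -> 'I_q -> R) d r K delta :
  0 <= K -> 0 < delta -> (energy r < +oo)%E ->
  (forall n b, `|d n b| <= K * rho ^+ n) ->
  (forall h n b, `|h| <= delta -> `|c h n b| <= K * rho ^+ n) ->
  (forall h n b, `|h| <= delta ->
     `|c h n b - c 0 n b - h * d n b| <= K * h ^+ 2 * rho ^+ n) ->
  (h^-1 * (limn (series (filter_term (c h) r)) -
           limn (series (filter_term (c 0) r)))) @[h --> 0^'] -->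
  limn (series (filter_term d r)).
Proof.
move=> K0 delta0 roo dK cK cdK.
pose S := limn (series (fun n => rho ^+ n * \sum_b `|r n b|)).
have bound h : h != 0 -> `|h| <= delta ->
    `|h^-1 * (limn (series (filter_term (c h) r)) -
       limn (series (filter_term (c 0) r))) -
       limn (series (filter_term d r))| <= K * S * `|h|.
  move=> h0 hdelta.
  have c0K n b : `|c 0 n b| <= K * rho ^+ n by apply: cK; rewrite normr0 ltW.
  have cvgh := filter_cvg K0 (fun n b => cK h n b hdelta) roo.
  have cvg0 := filter_cvg K0 c0K roo.
  have cvgd := filter_cvg K0 dK roo.
  have -> : h^-1 * (limn (series (filter_term (c h) r)) -
      limn (series (filter_term (c 0) r))) - limn (series (filter_term d r)) =
      h^-1 * limn (series (filter_term (fun n b => c h n b - c 0 n b - h * d n b) r)).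
    have -> : filter_term (fun n b => c h n b - c 0 n b - h * d n b) r =
        filter_term (c h) r - filter_term (c 0) r - h *: filter_term d r.
      apply/funext => n; rewrite /filter_term !fctE scaler_sumr -!sumrB.
      by apply: eq_bigr => b _; rewrite /GRing.scale/=; ring.
    rewrite lim_seriesB//; last 2 first.
      exact: is_cvg_seriesB.
      exact: is_cvg_seriesZ.
    rewrite lim_seriesB// lim_seriesZ// /GRing.scale/= [RHS]mulrBr.
    by rewrite mulKf.
  rewrite normrM normfV.
  have hK0 : 0 <= K * h ^+ 2 by rewrite mulr_ge0// sqr_ge0.
  have := filter_lim_le hK0 (fun n b => cdK h n b hdelta) roo.
  rewrite -/S -[h ^+ 2]real_normK ?num_real// => le_lim.
  rewrite ler_pdivrMl ?normr_gt0//.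
  apply: (le_trans le_lim); rewrite le_eqVlt; apply/orP; left; apply/eqP; ring.
apply/cvgrPdist_le => e e0.
have KS1 : 0 < `|K * S| + 1 by rewrite ltr_wpDl.
near=> h.
rewrite distrC (le_trans (bound h _ _))//.
- by near: h; exact: nbhs_dnbhs_neq.
- near: h; apply: dnbhs0_le => //.
- apply: (@le_trans _ _ ((`|K * S| + 1) * `|h|)).
    by rewrite ler_wpM2r// (le_trans (ler_norm _))// lerDl.
  rewrite -ler_pdivlMl//; near: h; apply: dnbhs0_le.
  by rewrite mulr_gt0// invr_gt0.
Unshelve. all: by end_near. Qed.

End Paths.

(** * Filters driven by white noise *)

Section WhiteFilters.
Local Open Scope classical_set_scope.
Local Open Scope ereal_scope.
Context d (T : measurableType d) (R : realType) (P : probability T R).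
Variables (q : nat) (rho : R).
Hypotheses (rho0 : (0 <= rho)%R) (rho1 : (rho < 1)%R).
Variables (u : nat -> 'I_q -> {RV P >-> R}) (v : 'I_q -> R).
Hypothesis uL2 : forall n b, (u n b : T -> R) \in Lfun P 2%:E.
(* The inputs are orthogonal, with [v b] the second moment of the [b]-th one. *)
Hypothesis uM : forall m n b b',
  'E_P[u m b \* u n b'] = (((m == n) && (b == b'))%:R * v b)%:E.

Let path w n b := u n b w.
Let en w := energy rho (path w).

Definition regular_paths : set T := [set w | en w < +oo].

Let term_ge0 n w : 0 <= (rho ^+ n * \sum_b u n b w ^+ 2)%:E.
Proof.
rewrite lee_fin mulr_ge0 ?exprn_ge0//.
by apply: sumr_ge0 => b _; rewrite sqr_ge0.
Qed.

Let mterm n :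
  measurable_fun [set: T] (fun w => (rho ^+ n * \sum_b u n b w ^+ 2)%:E).
Proof.
apply/measurable_EFinP; apply: measurable_funM => //.
by apply: measurable_sum => b; exact: measurable_funX.
Qed.

Let men : measurable_fun [set: T] en.
Proof. by apply: ge0_emeasurable_sum => // k w _ _; exact: term_ge0. Qed.

Let v_ge0 b : (0 <= v b)%R.
Proof.
have := uM 0 0 b b; rewrite !eqxx mul1r => vE.
rewrite -lee_fin -vE; apply: expectation_ge0 => w.
by rewrite /= -expr2 sqr_ge0.
Qed.

Let int_term n : \int[P]_w (rho ^+ n * \sum_b u n b w ^+ 2)%:E =
  (rho ^+ n * \sum_b v b)%:E.
Proof.
under eq_integral do rewrite EFinM.
rewrite ge0_integralZl//; first last.
- by rewrite lee_fin exprn_ge0.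
- by move=> w _; rewrite lee_fin; apply: sumr_ge0 => b _; rewrite sqr_ge0.
- apply/measurable_EFinP; apply: measurable_sum => b.
  exact: measurable_funX.
rewrite EFinM; congr (_ * _).
under eq_integral do rewrite -sumEFin.
rewrite ge0_integral_sum//; first last.
- by move=> b w _; rewrite lee_fin sqr_ge0.
- by move=> b; apply/measurable_EFinP; exact: measurable_funX.
rewrite -sumEFin; apply: eq_bigr => b _.
have := uM n n b b; rewrite !eqxx mul1r => <-.
by rewrite unlock.
Qed.

Let int_en : \int[P]_w en w <= ((\sum_b v b) / (1 - rho))%:E.
Proof.
rewrite /en /energy integral_nneseries//; last by move=> n w _; exact: term_ge0.
under eq_eseriesr do rewrite int_term.
apply: lime_le.
  apply: is_cvg_nneseries => n _ _.
  by rewrite lee_fin mulr_ge0 ?exprn_ge0// sumr_ge0.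
apply: nearW => N; rewrite sumEFin lee_fin -mulr_suml mulrC.
by rewrite big_mkord ler_wpM2l ?sumr_ge0// geometric_partial_le.
Qed.

Let integrable_en : P.-integrable [set: T] en.
Proof.
apply/integrableP; split => //.
under eq_integral => w _ do rewrite gee0_abs ?energy_ge0//.
exact: le_lt_trans int_en (ltry _).
Qed.

Lemma measurable_regular_paths : measurable regular_paths.
Proof.
rewrite -[X in measurable X]setTI; exact: emeasurable_fun_infty_o.
Qed.

(** The expected energy is at most [(\sum_b v b) / (1 - rho)], by monotone
    convergence. *)
Lemma irregular_paths_null : P (~` regular_paths) = 0.
Proof.
apply: measure_negligible; first exact/measurableC/measurable_regular_paths.
have := integrable_ae measurableT integrable_en; apply: negligibleS => w /= wirr.
by move=> /(_ I) wfin; apply: wirr; rewrite /regular_paths /= ltey_eq wfin.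
Qed.

Section TwoFilters.
Variables (c g : nat -> 'I_q -> R) (K : R).
Hypothesis K0 : (0 <= K)%R.
Hypothesis cK : forall n b, (`|c n b| <= K * rho ^+ n)%R.
Hypothesis dK : forall n b, (`|g n b| <= K * rho ^+ n)%R.

Let S e w := series (filter_term e (path w)).

Let mS e N : measurable_fun [set: T] (S e ^~ N).
Proof.
under eq_fun do rewrite /S seriesEord.
apply: measurable_sum => n; apply: measurable_sum => b.
exact: measurable_funM.
Qed.

Let SE e w N : S e w N = (\sum_(p : 'I_N * 'I_q) e p.1 p.2 * u p.1 p.2 w)%R.
Proof.
by rewrite /S seriesEord/= -(pair_bigA _ (fun (n : 'I_N) b => e n b * u n b w)%R).
Qed.

Let int_partial N : \int[P]_w (S c w N * S g w N)%:E =
  (series (fun n => \sum_b v b * (c n b * g n b)) N)%:E.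
Proof.
have uuL1 m b n b' : (u m b \* u n b')%R \in Lfun P 1 by exact: Lfun2_mul_Lfun1.
have prodE w : (S c w N * S g w N)%:E =
    \sum_(z : ('I_N * 'I_q) * ('I_N * 'I_q))
      (c z.1.1 z.1.2 * g z.2.1 z.2.2)%:E *
      (u z.1.1 z.1.2 w * u z.2.1 z.2.2 w)%:E.
  rewrite !SE big_distrlr/= pair_bigA -sumEFin; apply: eq_bigr => z _ /=.
  by rewrite -EFinM mulrACA.
under eq_integral do rewrite prodE.
rewrite integral_sum//; last first.
  by move=> z; apply: integrableZl => //; exact/Lfun1_integrable/uuL1.
have moment (z : ('I_N * 'I_q) * ('I_N * 'I_q)) : \int[P]_w ((c z.1.1 z.1.2 * g z.2.1 z.2.2)%:E *
      (u z.1.1 z.1.2 w * u z.2.1 z.2.2 w)%:E) =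
    ((z.1 == z.2)%:R * (v z.1.2 * (c z.1.1 z.1.2 * g z.2.1 z.2.2)))%:E.
  rewrite integralZl//; last exact/Lfun1_integrable/uuL1.
  have := uM z.1.1 z.2.1 z.1.2 z.2.2; rewrite unlock /= => ->.
  case: z => [[m b] [n b']]/=; rewrite xpair_eqE -EFinM; congr EFin.
  by ring.
under eq_bigr do rewrite moment.
rewrite sumEFin seriesEord/=; congr EFin.
rewrite -(pair_bigA _ (fun p p' : 'I_N * 'I_q =>
  (p == p')%:R * (v p.2 * (c p.1 p.2 * g p'.1 p'.2)))%R)/=.
rewrite (pair_bigA _ (fun (n : 'I_N) b => v b * (c n b * g n b))%R)/=.
apply: eq_bigr => p _; rewrite (bigD1 p)//= eqxx mul1r big1 ?addr0// => p' p'p.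
by rewrite eq_sym (negbTE p'p) mul0r.
Qed.

Let limS e : (forall n b, (`|e n b| <= K * rho ^+ n)%R) ->
  forall w, regular_paths w -> S e w N @[N --> \oo] --> limn (S e w).
Proof. by move=> eK w wreg; exact: (filter_cvg rho0 rho1 K0 eK wreg). Qed.

(* The partial products are dominated by a multiple of the energy, because
   [x * y] is at most the mean of [x ^+ 2] and [y ^+ 2]. *)
Let dominated :
  P.-integrable regular_paths (fun w => (limn (S c w) * limn (S g w))%:E) /\
  \int[P]_(w in regular_paths) (S c w N * S g w N)%:E @[N --> \oo] -->
  \int[P]_(w in regular_paths) (limn (S c w) * limn (S g w))%:E.
Proof.
pose C := (K ^+ 2 * (q%:R / (1 - rho)))%R.
have mreg := measurable_regular_paths.
have mprod N : measurable_fun regular_paths (fun w => (S c w N * S g w N)%:E).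
  apply/measurable_EFinP; apply: measurable_funM; exact: measurable_funTS.
have cvgprod w : regular_paths w ->
    (S c w N * S g w N)%R @[N --> \oo] --> (limn (S c w) * limn (S g w))%R.
  by move=> wreg; apply: cvgM; exact: limS.
have [||||i _ cvgi] := @dominated_convergence _ _ _ P _ mreg
  (fun N w => (S c w N * S g w N)%:E)
  (fun w => (limn (S c w) * limn (S g w))%:E) (fun w => C%:E * en w) mprod.
- apply/measurable_EFinP; apply: measurable_fun_cvg cvgprod => N.
  by apply/measurable_EFinP; exact: mprod.
- apply: aeW => w wreg; apply: cvg_EFin; first exact: nearW.
  exact: cvgprod.
- by apply: integrableZl => //; apply: integrableS integrable_en.
- apply: aeW => w N wreg.
  have wfin : en w \is a fin_num by rewrite ge0_fin_numE// energy_ge0.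
  rewrite -(fineK wfin) -EFinM lee_fin.
  have cS := filter_partial_sqr_le rho0 rho1 K0 cK wreg N.
  have dS := filter_partial_sqr_le rho0 rho1 K0 dK wreg N.
  have : (0 <= (`|S c w N| - `|S g w N|) ^+ 2)%R by exact: sqr_ge0.
  rewrite normrM sqrrB !real_normK ?num_real//.
  by move: cS dS; rewrite -/(S c w) -/(S g w) -/C -/(en w); lra.
by split.
Qed.

Lemma integrable_filter_product : P.-integrable regular_paths
  (fun w => (limn (S c w) * limn (S g w))%:E).
Proof. by have [] := dominated. Qed.

(** By orthogonality, the expected product of two partial outputs is a partial
    sum of the products of the coefficients; dominated convergence passes to the
    limit. *)
Lemma cvg_filter_product :
  series (fun n => \sum_b v b * (c n b * g n b))%R N @[N --> \oo] -->
  fine (\int[P]_(w in regular_paths) (limn (S c w) * limn (S g w))%:E).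
Proof.
have [int_lim] := dominated.
under eq_fun do rewrite -(integral_conull _ measurable_regular_paths irregular_paths_null) int_partial.
rewrite -(fineK (integrable_fin_num _ int_lim)); last exact: measurable_regular_paths.
by move/fine_cvg.
Qed.

End TwoFilters.

End WhiteFilters.

(** * Powers of a perturbed matrix *)

Section MatrixPowers.
Context (R : realType) (n : nat).
Implicit Types (A E M : 'M[R]_n).

(** The derivative of [(A + h *: E) ^+ m] at [h = 0], by the product rule for
    [A * A ^+ m]. *)
Fixpoint dmxpow A E (m : nat) : 'M[R]_n :=
  if m is m'.+1 then E *m A ^+ m' + A *m dmxpow A E m' else 0.

(** That is, the operator norm of [A] for the maximum norm is at most [alpha]. *)
Definition row_sums_le A (alpha : R) := forall i, \sum_j `|A i j| <= alpha.

Lemma mulmx_entry_le A M alpha mu i k : 0 <= mu -> row_sums_le A alpha ->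
  (forall j, `|M j k| <= mu) -> `|(A *m M) i k| <= alpha * mu.
Proof.
move=> mu0 Aalpha Mmu; rewrite mxE (le_trans (ler_norm_sum _ _ _))//.
apply: (@le_trans _ _ (\sum_j `|A i j| * mu)).
  by apply: ler_sum => j _; rewrite normrM ler_wpM2l.
by rewrite -mulr_suml ler_wpM2r.
Qed.

Variables (A E : 'M[R]_n) (alpha delta : R).
Hypotheses (alpha0 : 0 <= alpha) (delta0 : 0 < delta).
Hypotheses (Aalpha : row_sums_le A alpha) (E1 : row_sums_le E 1).

(* Cauchy-type estimates: the powers of [A + h *: E] are bounded by [rho ^+ m] for
   [`|h| <= delta], so the derivative, the increment and the second-order
   remainder are bounded by [rho ^+ m] up to powers of [h] and [delta], without
   the polynomial factors in [m] that a direct expansion would produce. *)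
Let rho := alpha + delta.
Let rho0 : 0 <= rho. Proof. by rewrite addr_ge0// ltW. Qed.

Lemma row_sums_perturb_le h : `|h| <= delta -> row_sums_le (A + h *: E) rho.
Proof.
move=> hdelta i.
apply: (@le_trans _ _ (\sum_j `|A i j| + `|h| * \sum_j `|E i j|)).
  rewrite mulr_sumr -big_split/=; apply: ler_sum => j _.
  by rewrite !mxE (le_trans (ler_normD _ _))// normrM.
rewrite lerD// -[leRHS]mulr1 ler_pM//.
by apply: sumr_ge0 => j _.
Qed.

Lemma expmx_entry_le M m i j : row_sums_le M rho -> `|(M ^+ m) i j| <= rho ^+ m.
Proof.
move=> Mrho; elim: m i j => [|m IHm] i j.
  by rewrite !expr0 mxE normr_nat lern1 leq_b1.
by rewrite !exprS mulmx_entry_le// ?exprn_ge0.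
Qed.

Let Arho : row_sums_le A rho.
Proof. by move=> i; rewrite (le_trans (Aalpha i))// lerDl ltW. Qed.

Lemma dmxpow_entry_le m i j : `|dmxpow A E m i j| <= delta^-1 * rho ^+ m.
Proof.
elim: m i j => [|m IHm] i j.
  by rewrite mxE normr0 mulr1 invr_ge0 ltW.
rewrite /= mxE (le_trans (ler_normD _ _))//.
have EA : `|(E *m A ^+ m) i j| <= 1 * rho ^+ m.
  rewrite mulmx_entry_le// ?exprn_ge0// => k; exact: expmx_entry_le.
have AD : `|(A *m dmxpow A E m) i j| <= alpha * (delta^-1 * rho ^+ m).
  by rewrite mulmx_entry_le// mulr_ge0 ?exprn_ge0// invr_ge0 ltW.
apply: (le_trans (lerD EA AD)); rewrite exprS le_eqVlt; apply/orP; left.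
apply/eqP; rewrite {3}/rho; field.
by rewrite gt_eqF.
Qed.

Lemma expmx_perturb_le m h i j : `|h| <= delta ->
  `|((A + h *: E) ^+ m - A ^+ m) i j| <= `|h| / delta * rho ^+ m.
Proof.
move=> hdelta; elim: m i j => [|m IHm] i j.
  by rewrite subrr mxE normr0 mulr1 mulr_ge0// invr_ge0 ltW.
have -> : (A + h *: E) ^+ m.+1 - A ^+ m.+1 =
    A *m ((A + h *: E) ^+ m - A ^+ m) + h *: (E *m (A + h *: E) ^+ m).
  rewrite !exprS -!mulmxE mulmxDl mulmxBr -scalemxAl.
  by rewrite addrAC.
rewrite mxE (le_trans (ler_normD _ _))// [X in _ + `|X|]mxE normrM.
have AB : `|(A *m ((A + h *: E) ^+ m - A ^+ m)) i j| <=
    alpha * (`|h| / delta * rho ^+ m).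
  rewrite mulmx_entry_le// mulr_ge0 ?exprn_ge0// mulr_ge0// invr_ge0 ltW//.
have EM : `|(E *m (A + h *: E) ^+ m) i j| <= 1 * rho ^+ m.
  rewrite mulmx_entry_le// ?exprn_ge0// => k.
  exact/expmx_entry_le/row_sums_perturb_le.
apply: (le_trans (lerD AB (ler_wpM2l (normr_ge0 h) EM))).
rewrite exprS le_eqVlt; apply/orP; left.
apply/eqP; rewrite {3}/rho; field.
by rewrite gt_eqF.
Qed.

Lemma expmx_taylor_le m h i j : `|h| <= delta ->
  `|((A + h *: E) ^+ m - A ^+ m - h *: dmxpow A E m) i j| <=
  h ^+ 2 / delta ^+ 2 * rho ^+ m.
Proof.
move=> hdelta; elim: m i j => [|m IHm] i j.
  rewrite subrr scaler0 subr0 mxE normr0 mulr1.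
  by rewrite mulr_ge0 ?sqr_ge0// invr_ge0 sqr_ge0.
have -> : (A + h *: E) ^+ m.+1 - A ^+ m.+1 - h *: dmxpow A E m.+1 =
    A *m ((A + h *: E) ^+ m - A ^+ m - h *: dmxpow A E m) +
    h *: (E *m ((A + h *: E) ^+ m - A ^+ m)).
  rewrite !exprS -!mulmxE /= mulmxDl !mulmxBr -scalemxAl -scalemxAr.
  rewrite !scalerDr !scalerN !opprD !addrA.

  set x := A *m (A + _) ^+ m; set z := A *m A ^+ m.
  by rewrite [LHS]addrAC (addrAC x) (addrAC (x - z)).
rewrite mxE (le_trans (ler_normD _ _))// [X in _ + `|X|]mxE normrM.
have AR : `|(A *m ((A + h *: E) ^+ m - A ^+ m - h *: dmxpow A E m)) i j| <=
    alpha * (h ^+ 2 / delta ^+ 2 * rho ^+ m).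
  rewrite mulmx_entry_le// mulr_ge0 ?exprn_ge0// mulr_ge0 ?sqr_ge0//.
  by rewrite invr_ge0 sqr_ge0.
have EB : `|(E *m ((A + h *: E) ^+ m - A ^+ m)) i j| <=
    1 * (`|h| / delta * rho ^+ m).
  rewrite mulmx_entry_le// ?mulr_ge0 ?exprn_ge0// ?invr_ge0 ?ltW// => k.
  exact: expmx_perturb_le.
apply: (le_trans (lerD AR (ler_wpM2l (normr_ge0 h) EB))).
rewrite (exprS rho) -[h ^+ 2]real_normK ?num_real// le_eqVlt; apply/orP; left.
apply/eqP; rewrite {3}/rho; field.
by rewrite gt_eqF.
Qed.

End MatrixPowers.

(** * The information matrix of a stable network *)

Lemma invmx_diag (F : fieldType) (n : nat) (v : 'rV[F]_n) :
  (forall j, v 0 j != 0) -> invmx (diag_mx v) = diag_mx (\row_j (v 0 j)^-1).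
Proof.
move=> v0; set W := diag_mx (\row_j _).
have VW : diag_mx v *m W = 1%:M.
  rewrite mulmx_diag; apply/matrixP => i j; rewrite !mxE.
  by case: eqP => // ->; rewrite mulfV.
have [uV _] := mulmx1_unit VW.
by rewrite -[LHS]mulmx1 -VW mulmxA mulVmx// mul1mx.
Qed.

Section Information.
Local Open Scope classical_set_scope.
Context (R : realType) (n p : nat) (B C : {set 'I_n}).
Context (sigma2 lambda : 'I_n -> R) (X : experiment B C sigma2 lambda).
Variables (A : 'rV[R]_p -> 'M[R]_n) (theta0 : 'rV[R]_p).
Variables (E : 'I_p -> 'M[R]_n) (alpha : R).
Hypothesis affineA :
  forall k h, A (h *: delta_mx 0 k + theta0) = A theta0 + h *: E k.
Hypotheses (alpha0 : 0 <= alpha) (alpha1 : alpha < 1).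
Hypotheses (Aalpha : row_sums_le (A theta0) alpha).
Hypothesis E1 : forall k, row_sums_le (E k) 1.
Variable t : int.

Definition gramian (k l : 'I_p) (j i : 'I_n) : R^nat := fun m =>
  dmxpow (A theta0) (E k) m j i * dmxpow (A theta0) (E l) m j i.

(* Half of the stability margin is spent on moving the parameter, the other half
   keeps the decay rate [rho] below 1. *)
Let delta := (1 - alpha) / 2.
Let rho := alpha + delta.
Let K := 1 + delta^-1 + delta^-2.

Let delta0 : 0 < delta. Proof. by rewrite divr_gt0 ?subr_gt0. Qed.
Let rho0 : 0 <= rho. Proof. by apply: addr_ge0 => //; exact: ltW. Qed.
Let rho1 : rho < 1. Proof. by move: alpha1; rewrite /rho /delta; lra. Qed.
Let dV0 : 0 < delta^-1. Proof. by rewrite invr_gt0. Qed.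
Let dVV0 : 0 < delta^-2. Proof. by rewrite invr_gt0 exprn_gt0. Qed.
Let K0 : 0 <= K. Proof. by rewrite /K !addr_ge0// ltW. Qed.

Let K_ge1 : 1 <= K. Proof. by rewrite /K -addrA lerDl addr_ge0// ltW. Qed.
Let K_geV : delta^-1 <= K.
Proof. by rewrite /K addrAC lerDr addr_ge0// ltW. Qed.
Let K_geVV : delta^-2 <= K. Proof. by rewrite /K lerDr addr_ge0// ltW. Qed.

Let u (m : nat) (b : 'I_#|B|) : {RV (prob X) >-> R} :=
  exc X (enum_val b) (t - m%:Z).
Let v (b : 'I_#|B|) := sigma2 (enum_val b).
Let path w m b := u m b w.
Let reg := regular_paths rho u.

Let uL2 m b : (u m b : _ -> R) \in Lfun (prob X) 2%:E.
Proof. by have [L2 _ _ _] := exc_white X (enum_valP b); exact: L2. Qed.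

Let uM m l b b' : 'E_(prob X)[u m b \* u l b']%E =
  (((m == l) && (b == b'))%:R * v b)%:E.
Proof.
rewrite (white_noise_cross_moment _ _ (@exc_white _ _ _ _ _ _ X) (exc_indep X)).
- rewrite (inj_eq enum_val_inj); congr ((_ && _)%:R * _)%:E.
  by rewrite (inj_eq (addrI _)) (inj_eq oppr_inj).
- exact: enum_valP.
- exact: enum_valP.
Qed.

Let dcoef k j m (b : 'I_#|B|) : R := dmxpow (A theta0) (E k) m j (enum_val b).

Let dcoef_le k j m b : `|dcoef k j m b| <= K * rho ^+ m.
Proof.
apply: (le_trans (dmxpow_entry_le alpha0 delta0 Aalpha (E1 k) m j _)).
by rewrite ler_wpM2r ?exprn_ge0.
Qed.

Let node_signalE th w i : @node_signal R n B C sigma2 lambda X th t w i 0 =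
  limn (series (filter_term (fun m b => (th ^+ m) i (enum_val b)) (path w))).
Proof.
rewrite mxE; congr (limn (series _)); apply/funext => m.
rewrite mxE; apply: eq_bigr => b _; congr (_ * _); last by rewrite mxE.
rewrite mxE (bigD1 (enum_val b))//= big1 => [|j jb].
  by rewrite mxE eqxx mulr1 addr0.
by rewrite mxE (negbTE jb) mulr0.
Qed.

Let predictorE th w j : @predictor R n B C sigma2 lambda X th t w j 0 =
  limn (series (filter_term (fun m b => (th ^+ m) (enum_val j) (enum_val b)) (path w))).
Proof.
rewrite mxE (bigD1 (enum_val j))//= big1 => [|i ij].
  by rewrite mxE eqxx mul1r addr0 node_signalE.
by rewrite mxE (negbTE ij) mul0r.
Qed.

(** On a regular path the predictor may be differentiated termwise. *)
Lemma psiE w k j : reg w -> psi A theta0 t w k j =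
  limn (series (filter_term (dcoef k (enum_val j)) (path w))).
Proof.
move=> wreg; rewrite mxE /derive.
apply: cvg_lim => //.
pose c h m (b : 'I_#|B|) : R := ((A theta0 + h *: E k) ^+ m) (enum_val j) (enum_val b).
have -> : (fun h => h^-1 *: (((fun th => predictor (A th) t w j 0) \o shift theta0)
      (h *: delta_mx 0 k) - predictor (A theta0) t w j 0)) =
    (fun h => h^-1 * (limn (series (filter_term (c h) (path w))) -
                      limn (series (filter_term (c 0) (path w))))).
  apply/funext => h; rewrite /= !predictorE affineA /GRing.scale/=.
  by rewrite /c scale0r addr0.
apply: (filter_derive rho0 rho1 K0 delta0 wreg).
- exact: dcoef_le.
- move=> h m b hdelta; apply: (@le_trans _ _ (rho ^+ m)).
    exact/expmx_entry_le/row_sums_perturb_le.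
  by rewrite ler_peMl ?exprn_ge0.
- move=> h m b hdelta.
  have := expmx_taylor_le alpha0 delta0 Aalpha (E1 k) m (enum_val j) (enum_val b) hdelta.
  rewrite /c scale0r addr0 !mxE => /le_trans; apply.
  by rewrite ler_wpM2r ?exprn_ge0// mulrC ler_wpM2r ?sqr_ge0.
Qed.

Lemma gramian_cvg k l j i : cvgn (series (gramian k l j i)).
Proof.
apply: normed_cvg; apply: (@series_le_cvg _ _ (geometric (K ^+ 2) rho)).
- by move=> m /=; exact: normr_ge0.
- by move=> m /=; rewrite mulr_ge0 ?sqr_ge0 ?exprn_ge0.
- move=> m /=; rewrite normrM.
  have D_le k' : `|dmxpow (A theta0) (E k') m j i| <= K * rho ^+ m.
    apply: (le_trans (dmxpow_entry_le alpha0 delta0 Aalpha (E1 k') m j i)).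
    by rewrite ler_wpM2r ?exprn_ge0.
  apply: (le_trans (ler_pM (normr_ge0 _) (normr_ge0 _) (D_le k) (D_le l))).
  rewrite mulrACA -expr2 ler_wpM2l ?sqr_ge0// ler_piMl ?exprn_ge0//.
  by rewrite exprn_ile1// ltW.
- by apply: is_cvg_geometric_series; rewrite ger0_norm.
Qed.

Hypothesis lambda0 : forall j, j \in C -> lambda j != 0.

(** Each measured output [j] contributes, for each excited node [i], the inner
    product of the gradients of the impulse response from [i] to [j], weighted by
    the signal-to-noise ratio. *)
Lemma information_mxE k l : information_mx X A theta0 t k l =
  \sum_(j in C) (lambda j)^-1 *
    \sum_(i in B) sigma2 i * limn (series (gramian k l j i)).
Proof.
have mreg : measurable reg by exact: measurable_regular_paths.
have reg1 : prob X (~` reg) = 0%E by exact: irregular_paths_null.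
pose L k' j w : R := limn (series (filter_term (dcoef k' j) (path w))).
have integrandE w : reg w ->
    (psi A theta0 t w *m invmx (@noise_cov R n C lambda) *m (psi A theta0 t w)^T) k l =
    \sum_(j < #|C|) (lambda (enum_val j))^-1 *
      (L k (enum_val j) w * L l (enum_val j) w).
  move=> wreg; have := psiE _ _ wreg; move: (psi _ _ _ _) => M ML.
  rewrite /noise_cov invmx_diag; last first.
    by move=> j; rewrite mxE lambda0// enum_valP.
  rewrite mul_mx_diag mxE; apply: eq_bigr => j _.
  by rewrite !mxE !ML -/(L _ _ _) -/(L _ _ _); ring.
rewrite mxE unlock (integral_conull _ mreg reg1).
under eq_integral => w /set_mem wreg.
  rewrite integrandE// -sumEFin; under eq_bigr do rewrite EFinM.
  over.
have intLL j : (prob X).-integrable reg (fun w => (L k j w * L l j w)%:E).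
  exact: (integrable_filter_product rho0 rho1 uM K0 (dcoef_le k j) (dcoef_le l j)).
rewrite integral_sum//; last by move=> j; apply: integrableZl.
under eq_bigr do rewrite integralZl//.
have intLLE j : (\int[prob X]_(w in reg) (L k j w * L l j w)%:E =
    (\sum_(i in B) sigma2 i * limn (series (gramian k l j i)))%:E)%E.
  have finLL := integrable_fin_num mreg (intLL j).
  rewrite -(fineK finLL); congr EFin.
  have cvgLL := cvg_filter_product rho0 rho1 uL2 uM K0 (dcoef_le k j) (dcoef_le l j).
  apply: (cvg_unique _ cvgLL) => //.
  rewrite (_ : series _ = fun N => \sum_(i in B) sigma2 i * series (gramian k l j i) N).
    apply: cvg_big => [|i _]; [exact: add_continuous|]; apply: cvgM; first exact: cvg_cst.
    exact: gramian_cvg.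
  apply/funext => N; rewrite seriesEord /= exchange_big/= [RHS]big_enum_val.
  by apply: eq_bigr => b _; rewrite seriesEord/= mulr_sumr.
under eq_bigr do rewrite intLLE -EFinM.
by rewrite sumEFin /= [RHS]big_enum_val.
Qed.

End Information.

(** * The symmetric two-node cycle *)

Lemma lim_series_gt0 (R : realType) (f : R^nat) (m : nat) :
  cvgn (series f) -> (forall k, 0 <= f k) -> 0 < f m -> 0 < limn (series f).
Proof.
move=> cf f0 fm; apply: (@lt_le_trans _ _ (series f m.+1)).
  by rewrite seriesSr ltr_wpDl// seriesEord sumr_ge0.
by apply: nondecreasing_cvgn_le => //; apply/nondecreasing_seqP => k; rewrite seriesSr lerDl.
Qed.

Lemma ord2P (P : 'I_2 -> Prop) : P 0 -> P 1 -> forall i, P i.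
Proof.
move=> P0 P1 [[|[|m]] lt_m]//.
  by rewrite (_ : Ordinal _ = 0) //; exact: val_inj.
by rewrite (_ : Ordinal _ = 1) //; exact: val_inj.
Qed.

Lemma sum_ord2 (R : nmodType) (f : 'I_2 -> R) : \sum_i f i = f 0 + f 1.
Proof.
by rewrite !big_ord_recl big_ord0 addr0; congr (_ + f _); exact: val_inj.
Qed.

Lemma invmx_2x2 (F : fieldType) (M : 'M[F]_2) :
  M 0 0 * M 1 1 - M 0 1 * M 1 0 != 0 ->
  let D := M 0 0 * M 1 1 - M 0 1 * M 1 0 in
  invmx M 0 0 = M 1 1 / D /\ invmx M 1 1 = M 0 0 / D.
Proof.
move=> D0 D.
pose N : 'M[F]_2 := \matrix_(i, j) ((if i == j then M (1 - i) (1 - i) else - M i j) / D).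
have NM : N *m M = 1%:M.
  apply/matrixP => i j; rewrite !mxE sum_ord2 !mxE.
  move: i j; apply: ord2P; apply: ord2P; rewrite /= ?subr0 ?subrr /D /=; by field.
have [_ uM] := mulmx1_unit NM.
have -> : invmx M = N by rewrite -[LHS]mul1mx -NM -mulmxA mulmxV// mulmx1.
by rewrite !mxE !eqxx subr0 subrr.
Qed.

Section Cycle.
Local Open Scope classical_set_scope.
Context (R : realType) (a : R).

Definition symmetric_cycle : 'M[R]_2 := two_node_cycle (const_mx a).
Definition cycle_dir (k : 'I_2) : 'M[R]_2 := two_node_cycle (delta_mx 0 k).
Local Notation A := symmetric_cycle.
Local Notation E := cycle_dir.
Local Notation D k m := (dmxpow A (E k) m).

Lemma cycle_affine k h :
  two_node_cycle (h *: delta_mx 0 k + const_mx a) = A + h *: E k.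
Proof.
apply/matrixP => i j; rewrite !mxE.
by case: ifP => _; [|case: ifP => _]; rewrite ?mxE ?mulr0 ?addr0// addrC.
Qed.

Lemma cycle_row_sums : row_sums_le A `|a|.
Proof.
by apply: ord2P; rewrite sum_ord2 !mxE/= normr0 ?addr0 ?add0r.
Qed.

Lemma cycle_dir_row_sums k : row_sums_le (E k) 1.
Proof.
by apply: ord2P; rewrite sum_ord2 !mxE/= normr0 ?addr0 ?add0r; case: (_ == _); rewrite ?normr1 ?normr0.
Qed.

Lemma cycle_sqr : A *m A = (a ^+ 2)%:M.
Proof.
apply/matrixP => i j; rewrite mxE sum_ord2 !mxE.
by move: i j; apply: ord2P; apply: ord2P => /=; ring.
Qed.

(** Differentiating [A *m A = (a12 * a21)%:M]: this is why the diagonal of the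
    derivative of a power does not depend on the parameter. *)
Lemma cycle_dir_anticomm k : E k *m A + A *m E k = a%:M.
Proof.
apply/matrixP => i j; rewrite !mxE !sum_ord2 !mxE.
by move: k i j; apply: ord2P; apply: ord2P; apply: ord2P => /=; ring.
Qed.

Lemma cycle_pow_even m : A ^+ m.*2 = (a ^+ m.*2)%:M.
Proof.
elim: m => [|m IHm]; first by rewrite !expr0.
rewrite doubleS !exprS IHm mulrA -!mulmxE cycle_sqr -scalar_mxM.
by rewrite mulrA.
Qed.

(** The exponent [m.*2.-1] is truncated to 0 at [m = 0], where the factor [m%:R]
    vanishes anyway. *)
Lemma dmxpow_cycle k m :
  D k m.*2 = (m%:R * a ^+ m.*2.-1)%:M /\
  D k m.*2.+1 = a ^+ m.*2 *: E k + (m%:R * a ^+ m.*2.-1) *: A.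
Proof.
elim: m => [|m [IHe IHo]].
  rewrite /= !mul0r scale0r !expr0 scale1r mulmx0 mulmx1 !addr0.
  by split => //; apply/matrixP => i j; rewrite !mxE mul0rn.
have even : D k m.+1.*2 = (m.+1%:R * a ^+ m.+1.*2.-1)%:M.
  rewrite doubleS /= -[X in A *m X]/(D k m.*2.+1) IHo exprS -!mulmxE cycle_pow_even.
  rewrite mulmxDr -!scalemxAr cycle_sqr.
  rewrite mul_mx_scalar -scalemxAr addrA -scalerDr cycle_dir_anticomm.
  rewrite !scale_scalar_mx -raddfD; congr (_%:M).
  case: m {IHe IHo} => [|m]; first by rewrite double0 !exprS !expr0; ring.
  by rewrite doubleS /= !exprS -[m.+2%:R]natr1; ring.
split => //.
rewrite -[LHS]/(E k *m A ^+ m.+1.*2 + A *m D k m.+1.*2) even cycle_pow_even.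
by rewrite !mul_mx_scalar.
Qed.


(** The sensitivity to either parameter of the gain [a12 ^+ h * a21 ^+ h] of a
    walk of length [m = h.*2] from a node to itself. *)
Definition diag_gain (m : nat) : R :=
  if odd m then 0 else m./2%:R * a ^+ m.-1.

(** A walk of length [m = h.*2.+1] from one node to the other has gain
    [(a12 * a21) ^+ h] times the parameter of the edge that it uses [h.+1] times.
    The sensitivity is to that parameter if [direct] holds, and otherwise to the
    other parameter, which occurs [h] times. *)
Definition offdiag_gain (direct : bool) (m : nat) : R :=
  if odd m then a ^+ m.-1 * (direct + m./2)%:R else 0.

Lemma dmxpow_cycleE k m :
  [/\ D k m 0 0 = diag_gain m, D k m 1 1 = diag_gain m,
      D k m 0 1 = offdiag_gain (k == 0) m
    & D k m 1 0 = offdiag_gain (k == 1) m].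
Proof.
rewrite /diag_gain /offdiag_gain -[m in D _ m]odd_double_half.
have [even_part odd_part] := dmxpow_cycle k m./2.
case: (boolP (odd m)) => m_odd.
  rewrite add1n odd_part.
  have -> : m.-1 = (m./2).*2 by rewrite -[in LHS](odd_double_half m) m_odd.
  have aE : m./2%:R * a ^+ (m./2).*2.-1 * a = m./2%:R * a ^+ (m./2).*2.
    case: m./2 => [|h]; first by rewrite !mul0r.
    by rewrite doubleS /= [in RHS]exprS; ring.
  rewrite !mxE /=; split.
  - by rewrite !mulr0 addr0.
  - by rewrite !mulr0 addr0.
  - by rewrite aE natrD mulrDr [in RHS](mulrC _ m./2%:R) eq_sym.
  - by rewrite aE natrD mulrDr [in RHS](mulrC _ m./2%:R) eq_sym.
rewrite add0n even_part.
have -> : m.-1 = (m./2).*2.-1 by rewrite -[in LHS](odd_double_half m) (negbTE m_odd).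
by rewrite !mxE.
Qed.

Hypothesis a0 : a != 0.
Hypothesis a1 : `|a| < 1.

Local Notation gram := (gramian (@two_node_cycle R) (const_mx a) cycle_dir).

Let gram_cvg k l j i : cvgn (series (gram k l j i)).
Proof. exact: gramian_cvg (normr_ge0 a) a1 cycle_row_sums cycle_dir_row_sums _ _ _ _. Qed.

Definition loop_energy := limn (series (fun m => diag_gain m ^+ 2)).
Definition path_energy (b b' : bool) :=
  limn (series (fun m => offdiag_gain b m * offdiag_gain b' m)).

Lemma gramE k l :
  [/\ limn (series (gram k l 0 0)) = loop_energy,
      limn (series (gram k l 1 1)) = loop_energy,
      limn (series (gram k l 0 1)) = path_energy (k == 0) (l == 0)
    & limn (series (gram k l 1 0)) = path_energy (k == 1) (l == 1)].
Proof.
split; congr (limn (series _)); apply/funext => m; rewrite /gramian -/A;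
  by have [e00 e11 e01 e10] := dmxpow_cycleE k m;
     have [f00 f11 f01 f10] := dmxpow_cycleE l m;
     rewrite ?e00 ?e11 ?e01 ?e10 ?f00 ?f11 ?f01 ?f10 ?expr2.
Qed.

Let diag_cvg : cvgn (series (fun m => diag_gain m ^+ 2)).
Proof.
rewrite (_ : (fun m => _) = gram 0 0 0 0); first exact: gram_cvg.
apply/funext => m; rewrite /gramian -/A.
by have [-> _ _ _] := dmxpow_cycleE 0 m; rewrite expr2.
Qed.

Let offdiag_cvg b b' : cvgn (series (fun m => offdiag_gain b m * offdiag_gain b' m)).
Proof.
pose k (c : bool) : 'I_2 := if c then 0 else 1.
have kE c : (k c == 0) = c by case: c.
rewrite (_ : (fun m => _) = gram (k b) (k b') 0 1); first exact: gram_cvg.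
apply/funext => m; rewrite /gramian -/A.
have [_ _ -> _] := dmxpow_cycleE (k b) m.
by have [_ _ -> _] := dmxpow_cycleE (k b') m; rewrite !kE.
Qed.

Lemma loop_energy_gt0 : 0 < loop_energy.
Proof.
apply: (@lim_series_gt0 _ _ 2) => [//|m|]; first exact: sqr_ge0.
by rewrite exprn_even_gt0//= /diag_gain/= mul1r expr1.
Qed.

Lemma path_energy_quadratic (x y : R) :
  x ^+ 2 * path_energy true true + 2 * x * y * path_energy true false +
    y ^+ 2 * path_energy false false =
  limn (series (fun m => (x * offdiag_gain true m + y * offdiag_gain false m) ^+ 2)) /\
  cvgn (series (fun m => (x * offdiag_gain true m + y * offdiag_gain false m) ^+ 2)).
Proof.
have -> : (fun m => (x * offdiag_gain true m + y * offdiag_gain false m) ^+ 2) =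
  x ^+ 2 *: (fun m => offdiag_gain true m * offdiag_gain true m) +
  (2 * x * y) *: (fun m => offdiag_gain true m * offdiag_gain false m) +
  y ^+ 2 *: (fun m => offdiag_gain false m * offdiag_gain false m).
  by apply/funext => m; rewrite !fctE /GRing.scale/=; ring.
have cvgZ (c : R) b b' :
    cvgn (series (c *: (fun m => offdiag_gain b m * offdiag_gain b' m))).
  exact: is_cvg_seriesZ.
have cvgD := is_cvg_seriesD (cvgZ (x ^+ 2) true true) (cvgZ (2 * x * y) true false).
split; last by apply: is_cvg_seriesD.
by rewrite (lim_seriesD cvgD)// lim_seriesD// !lim_seriesZ.
Qed.

Lemma path_energy_false_gt0 : 0 < path_energy false false.
Proof.
apply: (@lim_series_gt0 _ _ 3) => [//|m|]; first by rewrite -expr2 sqr_ge0.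
rewrite -expr2 exprn_even_gt0//= /offdiag_gain/= mulf_neq0// ?expf_neq0//.
Qed.

(** Termwise, an [h.+1]-fold dependence outweighs an [h]-fold one; the edge
    itself, [m = 1], makes the inequality strict. *)
Lemma path_energy_lt : path_energy false false < path_energy true true.
Proof.
rewrite -subr_gt0 /path_energy -lim_seriesB//.
apply: (@lim_series_gt0 _ _ 1); first exact: is_cvg_seriesB.
  move=> m; rewrite !fctE /offdiag_gain; case: ifP => _; last by rewrite mulr0 subrr.
  by rewrite -!expr2 !exprMn -mulrBr mulr_ge0 ?sqr_ge0// subr_ge0 lerXn2r ?nnegrE// ler_nat leq_addl.
by rewrite !fctE /offdiag_gain /= !mulr0 subr0 addn0 expr0 !mulr1 ltr01.
Qed.

(** This is the squared distance of the two off-diagonal sensitivities; they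
    differ at [m = 1]. *)
Lemma path_energy_distance_gt0 : 0 < path_energy true true + path_energy false false
  - 2 * path_energy true false.
Proof.
have [qE qcvg] := path_energy_quadratic 1 (-1).
rewrite (_ : _ - _ = 1 ^+ 2 * path_energy true true + 2 * 1 * (-1) * path_energy true false +
    (-1) ^+ 2 * path_energy false false); last by ring.
rewrite qE; apply: (@lim_series_gt0 _ _ 1) => // [m|]; first exact: sqr_ge0.
by rewrite /offdiag_gain/= !mul1r mulr0 addr0 expr1n.
Qed.

(** The quadratic form of the path energies is nonnegative; it is evaluated at
    the vector that minimizes it for a given first coordinate. *)
Lemma path_energy_cauchy_schwarz :
  path_energy true false ^+ 2 <= path_energy true true * path_energy false false.
Proof.
have [qE qcvg] := path_energy_quadratic (path_energy false false) (- path_energy true false).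
have : 0 <= path_energy false false * (path_energy true true * path_energy false false -
    path_energy true false ^+ 2).
  rewrite (_ : _ * _ = path_energy false false ^+ 2 * path_energy true true +
    2 * path_energy false false * (- path_energy true false) * path_energy true false +
    (- path_energy true false) ^+ 2 * path_energy false false); last by ring.
  rewrite qE; apply: limr_ge => //; apply: nearW => N.
  by rewrite seriesEord sumr_ge0// => m _; rewrite sqr_ge0.
by rewrite pmulr_rge0 ?path_energy_false_gt0// subr_ge0.
Qed.

(** Writing [S], [F], [G], [H] for the energies, the determinant is
    [S * (F + H - 2 * G) + (F * H - G ^+ 2)]. *)
Lemma cycle_energy_det_gt0 :
  0 < (loop_energy + path_energy true true) * (loop_energy + path_energy false false)
      - (loop_energy + path_energy true false) ^+ 2.
Proof.
have := path_energy_cauchy_schwarz; have := mulr_gt0 loop_energy_gt0 path_energy_distance_gt0.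
by lra.
Qed.

End Cycle.

(** * The four excitation and measurement patterns *)

Section Patterns.
Context (R : realType) (a : R) (sigma2 lambda : R).
Hypotheses (a1 : `|a| < 1) (lambda0 : lambda != 0).
Variable t : int.

(** The information matrix when only the walks from node 2 to node 1 ([b] true) or
    only those from node 1 to node 2 ([b] false) are observed, besides the walks
    from one of the nodes to itself. The two matrices differ by an exchange of the
    parameters. *)
Definition cycle_information (b : bool) : 'M[R]_2 := \matrix_(k, l)
  (sigma2 / lambda * (loop_energy a + path_energy a ((k == 0) == b) ((l == 0) == b))).

Let information_cycleE (B C : {set 'I_2})
    (X : experiment B C (fun=> sigma2) (fun=> lambda)) k l :
  information_mx X (@two_node_cycle R) (const_mx a) t k l =
  \sum_(j in C) lambda^-1 * \sum_(i in B) sigma2 *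
    limn (series (gramian (@two_node_cycle R) (const_mx a) (@cycle_dir R) k l j i)).
Proof.
exact: (information_mxE X (cycle_affine a) (normr_ge0 a) a1
  (cycle_row_sums a) (@cycle_dir_row_sums R)).
Qed.

Let sum_nodes (F : 'I_2 -> R) : \sum_(i in [set node1; node2]) F i = F 0 + F 1.
Proof. by rewrite big_setU1 ?inE//= big_set1. Qed.

Let ord2_eq1 (k : 'I_2) : (k == 1) = ((k == 0) == false).
Proof. by move: k; exact: ord2P. Qed.

Lemma informationI
    (X : experiment [set node1; node2] [set node1] (fun=> sigma2) (fun=> lambda)) :
  information_mx X (@two_node_cycle R) (const_mx a) t = cycle_information true.
Proof.
apply/matrixP => k l; rewrite information_cycleE big_set1 sum_nodes mxE.
by have [-> _ -> _] := gramE a k l; rewrite !eqb_id; field.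
Qed.

Lemma informationII
    (X : experiment [set node1; node2] [set node2] (fun=> sigma2) (fun=> lambda)) :
  information_mx X (@two_node_cycle R) (const_mx a) t = cycle_information false.
Proof.
apply/matrixP => k l; rewrite information_cycleE big_set1 sum_nodes mxE.
by have [_ -> _ ->] := gramE a k l; rewrite !ord2_eq1; field.
Qed.

Lemma informationIII
    (X : experiment [set node1] [set node1; node2] (fun=> sigma2) (fun=> lambda)) :
  information_mx X (@two_node_cycle R) (const_mx a) t = cycle_information false.
Proof.
apply/matrixP => k l; rewrite information_cycleE sum_nodes !big_set1 mxE.
by have [-> _ _ ->] := gramE a k l; rewrite !ord2_eq1; field.
Qed.

Lemma informationIV
    (X : experiment [set node2] [set node1; node2] (fun=> sigma2) (fun=> lambda)) :
  information_mx X (@two_node_cycle R) (const_mx a) t = cycle_information true.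
Proof.
apply/matrixP => k l; rewrite information_cycleE sum_nodes !big_set1 mxE.
by have [_ -> -> _] := gramE a k l; rewrite !eqb_id; field.
Qed.

Hypotheses (a0 : a != 0) (sigma0 : 0 < sigma2) (lambda_gt0 : 0 < lambda).

(** The two matrices have the same determinant, and inverting a 2 x 2 matrix
    exchanges its diagonal entries up to the determinant. *)
Lemma cycle_information_inv_diag : exists2 u : R, 0 < u & forall b k,
  invmx (cycle_information b) k k =
    u * (loop_energy a + path_energy a ((k == 0) != b) ((k == 0) != b)).
Proof.
set S := loop_energy a; set F := path_energy a true true.
set H := path_energy a false false; set G := path_energy a true false.
have GE : path_energy a false true = G.
  by congr (limn (series _)); apply/funext => m; rewrite mulrC.
have kappa0 : 0 < sigma2 / lambda by rewrite divr_gt0.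
have Delta0 := cycle_energy_det_gt0 a0 a1.
pose Delta := (S + F) * (S + H) - (S + G) ^+ 2.
exists ((sigma2 / lambda) * Delta)^-1; first by rewrite invr_gt0 mulr_gt0.
have detE b : cycle_information b 0 0 * cycle_information b 1 1 - cycle_information b 0 1 * cycle_information b 1 0 =
    (sigma2 / lambda) ^+ 2 * Delta.
  by case: b; rewrite !mxE/= GE -/S -/F -/H -/G /Delta; ring.
move=> b k.
have [|e0 e1] := @invmx_2x2 _ (cycle_information b).
  by rewrite detE mulf_neq0 ?expf_neq0 ?gt_eqF.
rewrite detE in e0 e1.
move: k; apply: ord2P; rewrite ?e0 ?e1 mxE /=; case: b {e0 e1 detE} => /=;
  rewrite -/F -/H -/S; by field; rewrite ?gt_eqF.
Qed.

End Patterns.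

Theorem mainTheorem1 (R : realType) (theta0 : 'rV[R]_2) (a sigma2 lambda : R)
  (ha12 : theta0 0 par_a12 = a) (ha21 : theta0 0 par_a21 = a)
  (ha : a != 0)
  (hstable : `|theta0 0 par_a12 * theta0 0 par_a21| < 1)
  (hsigma : 0 < sigma2) (hlambda : 0 < lambda)
  (XI : experiment [set node1; node2] [set node1]
          (fun=> sigma2) (fun=> lambda))
  (XII : experiment [set node1; node2] [set node2]
          (fun=> sigma2) (fun=> lambda))
  (XIII : experiment [set node1] [set node1; node2]
          (fun=> sigma2) (fun=> lambda))
  (XIV : experiment [set node2] [set node1; node2]
          (fun=> sigma2) (fun=> lambda))
  (t : int) :
  let PI := asymptotic_cov XI (@two_node_cycle R) theta0 t in
  let PII := asymptotic_cov XII (@two_node_cycle R) theta0 t in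
  let PIII := asymptotic_cov XIII (@two_node_cycle R) theta0 t in
  let PIV := asymptotic_cov XIV (@two_node_cycle R) theta0 t in
  [/\ (PI = PIV /\ PII = PIII),
      [/\ \tr PI = \tr PII, \tr PII = \tr PIII & \tr PIII = \tr PIV]
    & [/\ PI par_a12 par_a12 < PII par_a12 par_a12,
          PI par_a21 par_a21 > PII par_a21 par_a21,
          PIV par_a12 par_a12 < PIII par_a12 par_a12
        & PIV par_a21 par_a21 > PIII par_a21 par_a21]].
Proof.
have theta0E : theta0 = const_mx a.
  by apply/rowP => k; rewrite mxE; move: k; apply: ord2P.
have a1 : `|a| < 1.
  move: hstable; rewrite ha12 ha21 normrM -expr2.
  by rewrite expr_lt1.
have lambda0 : lambda != 0 by rewrite gt_eqF.
rewrite /asymptotic_cov theta0E informationI// informationII// informationIII//.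
rewrite informationIV//= /par_a12 /par_a21.
have [u u0 invE] := cycle_information_inv_diag a1 ha hsigma hlambda.
have energy_lt := path_energy_lt a1.
have lt_inv : invmx (cycle_information a sigma2 lambda true) 0 0 <
    invmx (cycle_information a sigma2 lambda false) 0 0.
  by rewrite !invE/= ltr_pM2l// ltrD2l.
have gt_inv : invmx (cycle_information a sigma2 lambda false) 1 1 <
    invmx (cycle_information a sigma2 lambda true) 1 1.
  by rewrite !invE/= ltr_pM2l// ltrD2l.
have trE : \tr (invmx (cycle_information a sigma2 lambda true)) =
    \tr (invmx (cycle_information a sigma2 lambda false)).
  by rewrite /mxtrace !sum_ord2 !invE/= addrC.
by split.
Qed.
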